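(* For every nonempty finite family of pairwise disjoint circular discs of radii $\leq \frac{\pi}{2}$ on a sphere there exists a separating spherical polygonal tiling, i.e. a partition of the sphere into convex spherical polygons such that each cell contains exactly one disc of the family and every disc of the family is contained in a cell.
   Context: Distances and radii on the sphere are measured by central angle: the distance $\widehat{PQ}$ of two points $P,Q$ is the central angle of a shorter great circular arc joining them, and the circular disc with center $O$ and radius $r>0$ is the closed set of points $X$ with $\widehat{XO}\le r$. A convex spherical polygon is a convex region of the sphere bounded by finitely many arcs of great circles, i.e. a set with nonempty interior which is an intersection of finitely many closed hemispheres (the whole sphere, being the intersection of no hemispheres, is allowed). A partition (tiling) of the sphere into cells is a family of cells that cover the sphere and have pairwise disjoint interiors. A tiling by convex spherical polygons is separating for a family of discs if each cell contains exactly one disc of the family and every disc of the family is contained in some cell. *)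

(* Defs.v *)
From HB Require Import structures.
From mathcomp Require Import all_boot all_order all_algebra.
From mathcomp Require Import all_classical all_reals all_analysis.

Set Implicit Arguments.
Unset Strict Implicit.
Unset Printing Implicit Defensive.

Import Order.TTheory GRing.Theory Num.Theory.
Import numFieldNormedType.Exports.

Local Open Scope classical_set_scope.
Local Open Scope ring_scope.

(* The norm of the library on row vectors is the sup norm, so the Euclidean
   structure is given by the dot product. *)
Definition dot (R : realType) (u v : 'rV[R]_3) : R :=
  \sum_(i < 3) u 0 i * v 0 i.

(* The unit sphere suffices, since distances are central angles.  It is also
   used as a type, through the coercion set_type; subtype_topology makes this
   type a topological space, so that the interior of a set of points is taken
   relative to the sphere. *)
Definition sphere (R : realType) : set 'rV[R]_3 := [set x | dot x x = 1].
Arguments sphere R : clear implicits.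

(* The angle between the unit vectors P and Q, in [0, pi]. *)
Definition sdist (R : realType) (P Q : sphere R) : R :=
  acos (dot (val P) (val Q)).

Definition disc (R : realType) (O : sphere R) (r : R) : set (sphere R) :=
  [set X | sdist X O <= r].

Definition hemisphere (R : realType) (O : sphere R) : set (sphere R) :=
  disc O (pi / 2).

(* For H = set0 the intersection is the whole sphere. *)
Definition convex_polygon (R : realType) (P : set (sphere R)) : Prop :=
  P° !=set0 /\
  exists2 H : set (sphere R), finite_set H & P = \bigcap_(O in H) hemisphere O.

Definition tiling (R : realType) (T : set (set (sphere R))) : Prop :=
  \bigcup_(C in T) C = setT /\ trivIset T (fun C => C°).

Definition separating (R : realType) (T F : set (set (sphere R))) : Prop :=
  (forall C, T C -> exists! D, F D /\ D `<=` C) /\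
  (forall D, F D -> exists2 C, T C & D `<=` C).

(* Main.v *)
(** The cells are those of the spherical power diagram.  If the disc [i] has
    centre [O i] and radius [r i], let its cell consist of the points [X] with
    [cos (r i) * <X, O j> <= cos (r j) * <X, O i>] for all [j]; when no radius
    is [pi / 2] this says that [<X, O i> / cos (r i)] is maximal.  A point [X]
    of the disc [i] has [<X, O i> >= cos (r i)] and, by disjointness,
    [<X, O j> < cos (r j)], so it lies in the cell [i] since cosines of radii
    are nonnegative.  Two cells meet in a great circle, which has empty interior. *)

Require Import Defs.
From mathcomp Require Import all_boot all_order all_algebra.
From mathcomp Require Import all_classical all_reals all_analysis.
From mathcomp Require Import lra.

Import Order.TTheory GRing.Theory Num.Theory.
Import numFieldNormedType.Exports.

Set Implicit Arguments.
Unset Strict Implicit.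

Local Open Scope classical_set_scope.
Local Open Scope ring_scope.

Lemma finite_argmax {R : realType} {I : choiceType} (A : set I) (f : I -> R) :
  finite_set A -> A !=set0 -> exists2 i, A i & forall j, A j -> f j <= f i.
Proof.
move=> /finite_seqP[s ->]; elim: s => [[x]//|x s IH _].
have [->|/eqP s0] := eqVneq s [::].
  by exists x => [|j]; rewrite /= inE// => /eqP->.
have [|i si fi] := IH.
  by case: s s0 {IH} => // y s _; exists y; rewrite /= inE eqxx.
have [fix_|/ltW fxi] := leP (f i) (f x).
  exists x; first by rewrite /= inE eqxx.
  by move=> j /=; rewrite inE => /predU1P[->//|/fi/le_trans]; exact.
exists i; first by rewrite /= inE si orbT.
by move=> j /=; rewrite inE => /predU1P[->//|/fi].
Qed.

(** * Dot product, discs, great circles and hemispheres on the unit sphere *)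

Section SphereGeometry.
Context {R : realType}.
Implicit Types (u v w : 'rV[R]_3) (X Y O : sphere R).

Lemma dotC u v : dot u v = dot v u.
Proof. by apply: eq_bigr => i _; rewrite mulrC. Qed.

Lemma dotDl u v w : dot (u + v) w = dot u w + dot v w.
Proof. by rewrite -big_split; apply: eq_bigr => i _; rewrite mxE mulrDl. Qed.

Lemma dotZl (a : R) u v : dot (a *: u) v = a * dot u v.
Proof. by rewrite mulr_sumr; apply: eq_bigr => i _; rewrite mxE mulrA. Qed.

Lemma dotBl u v w : dot (u - v) w = dot u w - dot v w.
Proof. by rewrite dotDl -scaleN1r dotZl mulN1r. Qed.

Lemma dotDr u v w : dot u (v + w) = dot u v + dot u w.
Proof. by rewrite !(dotC u) dotDl. Qed.

Lemma dotZr (a : R) u v : dot u (a *: v) = a * dot u v.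
Proof. by rewrite !(dotC u) dotZl. Qed.

Lemma dotBr u v w : dot u (v - w) = dot u v - dot u w.
Proof. by rewrite !(dotC u) dotBl. Qed.

Lemma dot0r u : dot u 0 = 0.
Proof. by rewrite -(scale0r 0) dotZr mul0r. Qed.

Lemma dot_ge0 u : 0 <= dot u u.
Proof. by apply: sumr_ge0 => i _; rewrite -expr2 sqr_ge0. Qed.

Lemma dot_gt0 u : u != 0 -> 0 < dot u u.
Proof.
move=> u0; rewrite lt_def dot_ge0 andbT; apply: contra u0.
rewrite /dot psumr_eq0 => [/allP u0|i _]; last by rewrite -expr2 sqr_ge0.
apply/eqP/rowP => i; apply/eqP; rewrite mxE -sqrf_eq0 expr2.
by apply: u0; rewrite mem_index_enum.
Qed.

Lemma dot_sphere X : dot (val X) (val X) = 1.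
Proof. by case: X => x /= /set_mem. Qed.

Lemma dot_sphere_bound X Y : -1 <= dot (val X) (val Y) <= 1.
Proof.
have := dot_ge0 (val X + val Y); have := dot_ge0 (val X - val Y).
rewrite !(dotBl, dotBr, dotDl, dotDr) !dot_sphere (dotC (val Y)); lra.
Qed.

Lemma dot1_sphere u : dot u u = 1 -> exists X, val X = u.
Proof. by move=> u1; exists (SigSub (mem_set (u1 : sphere R u))). Qed.

Definition unitv u : 'rV[R]_3 := (Num.sqrt (dot u u))^-1 *: u.

Lemma unitv_gt0 u : u != 0 -> 0 < (Num.sqrt (dot u u))^-1.
Proof. by move=> /dot_gt0 u0; rewrite invr_gt0 sqrtr_gt0. Qed.

Lemma unitv_sphere u : u != 0 -> exists X, val X = unitv u.
Proof.
move=> u0; apply: dot1_sphere; rewrite dotZl dotZr mulrA -expr2 exprVn.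
by rewrite sqr_sqrtr ?dot_ge0// mulVf// gt_eqF// dot_gt0.
Qed.

(** Two linear equations in three unknowns have a nonzero common solution, which is then normalised.
    Hence any two great circles meet. *)
Lemma orthogonal_sphere u v :
  exists2 X : sphere R, dot (val X) u = 0 & dot (val X) v = 0.
Proof.
pose M := (col_mx u v)^T; pose w := nz_row (kermx M).
have w0 : w != 0.
  rewrite nz_row_eq0 -mxrank_eq0 mxrank_ker -lt0n subn_gt0.
  exact: leq_ltn_trans (rank_leq_col M) _.
have /sub_kermxP : (w <= kermx M)%MS by exact: nz_row_sub.
rewrite /M tr_col_mx mul_mx_row -row_mx0 => /eq_row_mx[wu wv].
have dotE (a b : 'rV[R]_3) : dot a b = (a *m b^T) 0 0.
  by rewrite mxE; apply: eq_bigr => i _; rewrite mxE.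
have [X XE] := unitv_sphere w0.
by exists X; rewrite XE dotZl [X in _ * X]dotE ?wu ?wv mxE mulr0.
Qed.

(** Cosine is strictly decreasing on [[0, pi]], where [acos] takes its values; from here on discs
    are handled as linear inequalities. *)
Lemma discE O (r : R) : 0 <= r <= pi ->
  disc O r = [set X | cos r <= dot (val X) (val O)].
Proof.
move=> r0pi; apply/funext => X; apply/propext; rewrite /disc /sdist /=.
have /acos_def[a0pi aE] := dot_sphere_bound X O.
by rewrite -[X in cos r <= X]aE !leNgt ltr_cos ?in_itv.
Qed.

Lemma hemisphereE O : hemisphere O = [set X | 0 <= dot (val X) (val O)].
Proof.
by rewrite /hemisphere discE ?cos_pihalf//; have := @pi_gt0 R; lra.
Qed.

Lemma continuous_dot v : continuous (fun u => dot u v).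
Proof.
have cu i : continuous (fun u => u 0 i * v 0 i).
  move=> u; apply: (cvgMr_tmp (F := nbhs u)); exact: coord_continuous.
have -> : (fun u => dot u v) =
    (fun u => u 0 0 * v 0 0 + u 0 1 * v 0 1 + u 0 2%:R * v 0 2%:R).
  apply/funext => u; rewrite /dot !big_ord_recl big_ord0 addr0 addrA.
  by congr (_ + _ * _ + _ * _); congr (_ _ _); apply: val_inj.
move=> u; apply: (cvgD (F := nbhs u)); last exact: cu.
by apply: (cvgD (F := nbhs u)); exact: cu.
Qed.

Lemma continuous_dot_sphere v : continuous (fun X => dot (val X) v).
Proof.
move=> X; apply: (@continuous_comp _ _ _ set_val (fun u => dot u v)).
  exact: initial_continuous.
exact: continuous_dot.
Qed.

Lemma disc_center_interior O (r : R) : 0 < r <= pi -> (disc O r)° O.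
Proof.
move=> /andP[r0 rpi]; rewrite discE ?(ltW r0)//.
apply: (@filterS _ _ _ [set X | cos r < dot (val X) (val O)]) => [X /ltW//|].
apply: (@continuous_dot_sphere (val O) O [set y | cos r < y]).
apply: open_nbhs_nbhs; split; first exact: open_gt.
by rewrite /= dot_sphere -(@cos0 R) ltr_cos// in_itv/= ?lexx ?(ltW r0)// pi_ge0.
Qed.

(* From a point of the great circle, rotate towards its pole. *)
Lemma great_circle_interior v : v != 0 ->
  [set X : sphere R | dot (val X) v = 0]° = set0.
Proof.
move=> v0; apply/seteqP; split => // X nX; rewrite /=.
have X0 := interior_subset nX; rewrite /= in X0.
have [V VE] := unitv_sphere v0.
pose g (t : R) : 'rV[R]_3 := cos t *: val X + sin t *: val V.
have XV : dot (val X) (val V) = 0 by rewrite VE dotZr X0 mulr0.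
have gS t : dot (g t) (g t) = 1.
  rewrite !(dotDl, dotDr, dotZl, dotZr) !dot_sphere (dotC (val V)) XV.
  by rewrite !mulr0 addr0 add0r !mulr1 -!expr2 cos2Dsin2.
pose h (t : R) : sphere R := SigSub (mem_set (gS t : sphere R (g t))).
have cg : continuous g.
  move=> t; apply: (cvgD (F := nbhs t)); apply: (cvgZr_tmp (F := nbhs t)).
    exact: continuous_cos.
  exact: continuous_sin.
have ch : continuous h by exact: (@continuous_comp_initial _ _ _ set_val h cg).
have h0 : h 0 = X.
  by apply: val_inj; rewrite /= /g cos0 sin0 scale1r scale0r addr0.
rewrite -h0 in nX; have gv0 := ch 0 _ nX.
(* By continuity [h t] stays on the great circle for small [t > 0], but its product with [v] is
   [sin t] times the length of [v], which is positive for [0 < t < pi]. *)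
near (0:R)^'+ => t.
have : dot (g t) v = 0.
  by near: t; exact: (@cvg_within _ (nbhs (0 : R)) _ _ _ gv0).
rewrite dotDl !dotZl X0 mulr0 add0r VE dotZl => /eqP; apply/negP.
rewrite !mulf_neq0 ?gt_eqF ?dot_gt0 ?unitv_gt0 ?sin_gt0_pi//.
apply/andP; split; near: t; first exact: nbhs_right_gt.
exact/nbhs_right_lt/pi_gt0.
Unshelve. all: by end_near. Qed.

(** Each nonzero normal is scaled to a point of the sphere, the pole of its hemisphere. A zero
    normal imposes no condition and is dropped, so [H] may be empty. *)
Lemma halfspaces_hemispheres (A : set 'rV[R]_3) : finite_set A ->
  exists2 H : set (sphere R), finite_set H &
    [set X | forall v, A v -> 0 <= dot (val X) v] =
    \bigcap_(O in H) hemisphere O.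
Proof.
move=> finA; exists (val @^-1` (unitv @` (A `\ 0))).
  apply: finite_preimage; first by move=> X Y _ _; exact: val_inj.
  exact/finite_image/finite_setD.
apply/seteqP; split => X /= HX.
  move=> O [v [Av /eqP v0]] vE; rewrite hemisphereE /= -vE dotZr.
  by rewrite pmulr_rge0 ?unitv_gt0// HX.
move=> v Av; have [->|v0] := eqVneq v 0; first by rewrite dot0r.
have [Y YE] := unitv_sphere v0.
have : hemisphere Y X by apply: HX; exists v => //; split => //; exact/eqP.
by rewrite hemisphereE /= YE dotZr pmulr_rge0// unitv_gt0.
Qed.

End SphereGeometry.

(** * The spherical power diagram of a finite family of disjoint discs *)

Section PowerDiagram.
Context {R : realType} {I : choiceType}.
Variables (F : set I) (O : I -> sphere R) (r : I -> R).
Hypotheses (finF : finite_set F) (F0 : F !=set0).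
Hypothesis rP : forall i, F i -> 0 < r i <= pi / 2.
Hypothesis disjF : trivIset F (fun i => disc (O i) (r i)).

Implicit Types X : sphere R.

Local Notation c i := (cos (r i)).
Local Notation "<[ X , i ]>" := (dot (val X) (val (O i))).

Definition cell i : set (sphere R) :=
  [set X : sphere R | forall j, F j -> c i * <[X, j]> <= c j * <[X, i]>].

(** Normal of the plane that bounds cell [i] against cell [j], pointing towards cell [i]; it
    vanishes for [j = i]. *)
Definition cell_normal i j : 'rV[R]_3 := c j *: val (O i) - c i *: val (O j).

Lemma dot_cell_normal X i j :
  dot (val X) (cell_normal i j) = c j * <[X, i]> - c i * <[X, j]>.
Proof. by rewrite dotBr !dotZr. Qed.

Let rpi i : F i -> 0 < r i <= pi.
Proof. by move=> /rP; lra. Qed.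

Let discE_ i : F i -> disc (O i) (r i) = [set X : sphere R | c i <= <[X, i]>].
Proof. by move=> /rpi ri; apply: discE; lra. Qed.

Let c_ge0 i : F i -> 0 <= c i.
Proof. by move=> /rP ri; apply: cos_ge0_pihalf; lra. Qed.

Let disjF_ i j X : F i -> F j -> c i <= <[X, i]> -> c j <= <[X, j]> -> i = j.
Proof.
by move=> Fi Fj Xi Xj; apply: disjF => //; exists X; split; rewrite discE_.
Qed.

(** Two closed hemispheres always share a point, namely one orthogonal to both centres. *)
Lemma cos_radius_eq0 i j : F i -> F j -> c i = 0 -> c j = 0 -> i = j.
Proof.
move=> Fi Fj ci cj; have [X Xi Xj] := orthogonal_sphere (val (O i)) (val (O j)).
by apply: (@disjF_ _ _ X) => //; rewrite ?Xi ?Xj ?ci ?cj.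
Qed.

Lemma cell_normal_neq0 i j : F i -> F j -> i <> j -> cell_normal i j != 0.
Proof.
move=> Fi Fj ij; apply/eqP => /subr0_eq nE; apply: ij.
(* Compare the squared lengths of the two equal vectors; both cosines are nonnegative. *)
have cc : c i = c j.
  have : dot (c j *: val (O i)) (c j *: val (O i)) = c i ^+ 2.
    by rewrite nE dotZl dotZr dot_sphere mulr1.
  rewrite dotZl dotZr dot_sphere mulr1 -expr2 => /eqP.
  by rewrite eqrXn2 ?c_ge0// => /eqP.
(* Either both discs are hemispheres, or the common factor cancels and the discs share their
   centre. *)
have [ci|ci] := eqVneq (c i) 0; first by apply: cos_radius_eq0; rewrite -?cc.
have OE : val (O i) = val (O j) by apply: (scalerI ci); rewrite {1}cc.
by apply: (@disjF_ _ _ (O i)) => //; rewrite -?OE dot_sphere cos_le1.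
Qed.

Lemma disc_sub_cell i : F i -> disc (O i) (r i) `<=` cell i.
Proof.
move=> Fi X; rewrite discE_// => /= Xi j Fj.
have [->//|/eqP ij] := eqVneq i j.
have Xj : <[X, j]> <= c j.
  by rewrite leNgt; apply/negP => /ltW Xj; apply: ij; exact: (@disjF_ _ _ X).
rewrite (le_trans (ler_wpM2l (c_ge0 Fi) Xj))// mulrC.
exact: (ler_wpM2l (c_ge0 Fj) Xi).
Qed.

Lemma cell_interior_disjoint i j X :
  F i -> F j -> (cell i)° X -> (cell j)° X -> i = j.
Proof.
move=> Fi Fj Xi Xj; apply: contrapT => ij.
have : [set Y : sphere R | dot (val Y) (cell_normal i j) = 0]° X.
  apply: filterS (filterI Xi Xj) => Y [/(_ j Fj) Yi /(_ i Fi) Yj] /=.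
  by rewrite dot_cell_normal; lra.
by rewrite great_circle_interior// cell_normal_neq0.
Qed.

Lemma cell_center_interior i : F i -> (cell i)° (O i).
Proof.
move=> Fi; apply: (interiorS (disc_sub_cell Fi)).
exact: disc_center_interior (rpi Fi).
Qed.

(** The centre of disc [j] would be interior to both cells. This gives the uniqueness of the disc in
    a cell. *)
Lemma disc_sub_cell_inj i j :
  F i -> F j -> disc (O j) (r j) `<=` cell i -> i = j.
Proof.
move=> Fi Fj ji; apply: (@cell_interior_disjoint i j (O j)) => //.
  by apply: (interiorS ji); exact: disc_center_interior (rpi Fj).
exact: cell_center_interior.
Qed.

Lemma cell_convex_polygon i : F i -> convex_polygon (cell i).
Proof.
move=> Fi; split; first by exists (O i); exact: cell_center_interior.
have [H finH HE] := halfspaces_hemispheres (finite_image (cell_normal i) finF).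
exists H => //; rewrite -HE; apply/seteqP; split => X /= Xi.
  by move=> _ [j Fj <-]; rewrite dot_cell_normal subr_ge0 Xi.
by move=> j Fj; rewrite -subr_ge0 -dot_cell_normal Xi//; exists j.
Qed.

(* At most one disc is a hemisphere, and then it is its own cell as soon as there
   are other discs; the remaining points are distributed by maximising
   [<X, O i> / cos (r i)] over the other discs. *)
Lemma cell_cover X : exists2 i, F i & cell i X.
Proof.
pose G := F `&` [set i | 0 < c i].
have notG i : F i -> ~ G i -> c i = 0.
  move=> Fi nGi; apply/eqP; rewrite eq_le c_ge0// andbT leNgt.
  by apply/negP => ci; exact: nGi.
have [[h [Fh ch Xh]]|noh] :=
  pselect (exists h, [/\ F h, c h = 0 & 0 <= <[X, h]>]).
  by exists h => // j Fj; rewrite ch mul0r mulr_ge0 ?c_ge0.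
have [G0|] := pselect (G !=set0).
  have [i [Fi /= ci] imax] :=
    @finite_argmax R _ _ (fun i => <[X, i]> / c i) (finite_setIl _ finF) G0.
  exists i => // j Fj; have [Gj|/notG-/(_ Fj) cj] := pselect (G j).
    have := imax j Gj; rewrite ler_pdivrMr ?(Gj.2)// => /(ler_wpM2l (ltW ci)).
    by rewrite mulrA (mulrC _ (_ / _)) divfK ?gt_eqF// mulrC [_ * c j]mulrC.
  (* Disc [j] is a hemisphere that misses [X], so the left side of its inequality is at most 0. *)
  rewrite cj mul0r pmulr_rle0// leNgt; apply/negP => /ltW Xj.
  by apply: noh; exists j.
(* All cosines vanish, so every defining inequality reads [0 <= 0] and any cell contains [X]. *)
move=> nG; have cF0 i : F i -> c i = 0.
  by move=> Fi; apply: notG => // Gi; apply: nG; exists i.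
by have [i Fi] := F0; exists i => // j Fj; rewrite (cF0 i)// (cF0 j)// !mul0r.
Qed.

End PowerDiagram.

Theorem theorem1 (R : realType) (F : set (set (sphere R))) :
  finite_set F -> F !=set0 ->
  (forall D, F D -> exists (O : sphere R) (r : R), 0 < r <= pi / 2 /\ D = disc O r) ->
  trivIset F id ->
  exists T : set (set (sphere R)),
    [/\ tiling T,
        (forall C, T C -> convex_polygon C) &
        separating T F].
Proof.
move=> finF F0 discF disjF.
(* Each disc serves as its own index in the power diagram, with a chosen centre and radius. Sets
   outside [F] get a dummy pair, whose point comes from a disc of the nonempty family. *)
have [p pP] : {p : set (sphere R) -> sphere R * R & forall D, F D ->
    0 < (p D).2 <= pi / 2 /\ D = disc (p D).1 (p D).2}.
  apply: (@choice _ _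
    (fun D q => F D -> 0 < q.2 <= pi / 2 /\ D = disc q.1 q.2)) => D.
  have [D0 /discF[X0 _]] := F0.
  have [/discF[X [r Xr]]|nFD] := pselect (F D); first by exists (X, r).
  by exists (X0, 0).
pose O D := (p D).1; pose r D := (p D).2.
have rP D : F D -> 0 < r D <= pi / 2 by case/pP.
have DE D : F D -> disc (O D) (r D) = D by case/pP.
have disjD : trivIset F (fun D => disc (O D) (r D)).
  by move=> D E FD FE; rewrite !DE//; exact: disjF.
exists (cell F O r @` F); split.
- split.
    apply/seteqP; split => // X _.
    have [D FD XD] := cell_cover O finF F0 rP X.
    by exists (cell F O r D) => //; exists D.
  move=> _ _ [D FD <-] [E FE <-] [X [XD XE]].
  by rewrite (cell_interior_disjoint rP disjD FD FE XD XE).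
- by move=> _ [D FD <-]; exact: (cell_convex_polygon finF rP disjD FD).
- split.
    move=> _ [D FD <-]; exists D; split.
      by split => //; rewrite -{1}(DE D FD); exact: (disc_sub_cell rP disjD FD).
    move=> E [FE ED]; apply: (disc_sub_cell_inj rP disjD FD FE).
    by rewrite DE.
  move=> D FD; exists (cell F O r D); first by exists D.
  by rewrite -{1}(DE D FD); exact: (disc_sub_cell rP disjD FD).
Qed.
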